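(* Let $\mathcal{I}$ be an ideal on $\omega$ such that $\mathcal{ED}\not\leq_{\mathrm{K}}\mathcal{I}\restriction A$ for all $A\in\mathcal{I}^+$. Let also $\mathcal{J}$ be a translation invariant ideal on $\omega$, and suppose that $\mathcal{J}\not\leq_{\mathrm{K}}\mathcal{I}\restriction A$ for all $A\in\mathcal{I}^+$. Then $\mathsf{H}_{\boldsymbol{b}}(\mathcal{J})\notin\mathscr{H}(\mathcal{I})$, where $\boldsymbol{b}=(2^n:n\in\omega)$.
   Context: $\omega=\{0,1,2,\dots\}$; $\mathbb{T}=\mathbb{R}/\mathbb{Z}$; $\|x\|:=\min\{|x-z|:z\in\mathbb{Z}\}$. An ideal on a countably infinite set $X$ is a family $\mathcal{I}\subseteq\mathcal{P}(X)$ closed under subsets and finite unions, containing all finite subsets of $X$, and with $X\notin\mathcal{I}$; $\mathcal{I}^+:=\mathcal{P}(X)\setminus\mathcal{I}$. For $A\in\mathcal{I}^+$, $\mathcal{I}\restriction A:=\{B\cap A:B\in\mathcal{I}\}$, an ideal on $A$. For ideals $\mathcal{I}$ on $X$ and $\mathcal{J}$ on $Y$, $\mathcal{I}\leq_{\mathrm{K}}\mathcal{J}$ (Katětov order) if there is $f:Y\to X$ with $f^{-1}[A]\in\mathcal{J}$ for every $A\in\mathcal{I}$. $\mathcal{ED}$ is the ideal on $\omega^2$ given by $\mathcal{ED}:=\{A\subseteq\omega^2:\sup_{i>k}|A_i|<\infty\text{ for some }k\in\omega\}$, where $A_i:=\{j\in\omega:(i,j)\in A\}$. An ideal $\mathcal{J}$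 on $\omega$ is translation invariant if for all $A\in\mathcal{J}$ and $n\in\omega$ we have $A-n:=\{k\in\omega:k+n\in A\}\in\mathcal{J}$. For $\boldsymbol{a}=(a_n:n\in\omega)\in\mathbb{Z}^\omega$ and an ideal $\mathcal{I}$ on $\omega$, $\mathsf{H}_{\boldsymbol{a}}(\mathcal{I}):=\{x\in\mathbb{T}:\{n\in\omega:\|a_nx\|\ge\varepsilon\}\in\mathcal{I}\text{ for all }\varepsilon>0\}$, and $\mathscr{H}(\mathcal{I}):=\{\mathsf{H}_{\boldsymbol{a}}(\mathcal{I}):\boldsymbol{a}\in\mathbb{Z}^\omega\}$. *)

(* Defs.v *)
From HB Require Import structures.
From mathcomp Require Import all_boot all_order all_algebra.
From mathcomp Require Import generic_quotient ring_quotient.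
From mathcomp Require Import all_classical all_reals.
From mathcomp Require Import ring.

Set Implicit Arguments.
Unset Strict Implicit.
Unset Printing Implicit Defensive.

Import Order.TTheory GRing.Theory Num.Theory.

Local Open Scope classical_set_scope.
Local Open Scope card_scope.
Local Open Scope ring_scope.

(* An ideal lives on a subset X of an ambient type, so that the restriction of
   an ideal on nat to A : set nat is an ideal on A over the same type. *)
Record is_ideal (T : Type) (X : set T) (I : set (set T)) : Prop := IsIdeal {
  ideal_carrier : X #= [set: nat];
  ideal_sub : forall A, I A -> A `<=` X;
  ideal_down : forall A B, I B -> A `<=` B -> I A;
  ideal_setU : forall A B, I A -> I B -> I (A `|` B);
  ideal_finite : forall A, A `<=` X -> finite_set A -> I A;
  ideal_proper : ~ I X }.

Definition ideal_positive (T : Type) (X : set T) (I : set (set T)) : set (set T) :=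
  [set A | A `<=` X /\ ~ I A].

Definition ideal_restrict (T : Type) (I : set (set T)) (A : set T) : set (set T) :=
  [set B `&` A | B in I].

(* I is a family of subsets of X, J a family of subsets of Y. A map Y -> X is
   a function f between the ambient types which sends Y into X, and the
   preimage of A under that map is Y `&` f @^-1` A. *)
Definition katetov_le (T U : Type) (X : set T) (I : set (set T))
    (Y : set U) (J : set (set U)) : Prop :=
  exists f : U -> T,
    set_fun Y X f /\ forall A, I A -> J (Y `&` f @^-1` A).

(* The bound m witnesses that the supremum of the cardinalities is finite. *)
Definition ED : set (set (nat * nat)) :=
  [set A | exists k m : nat, forall i : nat, (k < i)%N ->
     [set j | A (i, j)] #<= `I_m].

Definition translation_invariant (J : set (set nat)) : Prop :=
  forall A (n : nat), J A -> J [set k | A (k + n)%N].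

Definition integers (R : realType) : zmodClosed R :=
  GRing.ZmodClosed.clone R Num.int_num_subdef _.

Definition circle (R : realType) : Type :=
  {ideal_quot integers R}.

HB.instance Definition _ (R : realType) := GRing.Zmodule.on (circle R).

Definition to_circle (R : realType) (r : R) : circle R :=
  (\pi_({ideal_quot integers R}) r)%qT.

Definition int_dist (R : realType) (r : R) : R :=
  inf [set `|r - z%:~R| | z in [set: int]].

(* Independent of the chosen representative: see circle_norm_to_circle. *)
Definition circle_norm (R : realType) (x : circle R) : R := int_dist (repr x).

Definition Hset (R : realType) (a : nat -> int) (I : set (set nat)) :
    set (circle R) :=
  [set x | forall e : R, 0 < e -> I [set n | e <= circle_norm (x *~ a n)]].

Arguments Hset : clear implicits.

Definition scrH (R : realType) (I : set (set nat)) : set (set (circle R)) :=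
  range (fun a : nat -> int => Hset R a I).

Arguments scrH : clear implicits.

Section CircleFacts.
Variable R : realType.

Lemma int_dist_le (r : R) (z : int) : int_dist r <= `|r - z%:~R|.
Proof.
apply: ge_inf; last by exists z.
by exists 0 => _ [w _ <-]; exact: normr_ge0.
Qed.

(* The infimum defining int_dist is a minimum. *)
Lemma int_dist_min (r : R) : exists z : int, int_dist r = `|r - z%:~R|.
Proof.
pose f := Num.floor r.
have fr : f%:~R <= r by exact: Num.Theory.floor_le.
have rf : r < (f + 1)%:~R by exact: Num.Theory.floorD1_gt.
pose z := if `|r - f%:~R| <= `|r - (f + 1)%:~R| then f else f + 1.
exists z; apply/eqP; rewrite eq_le int_dist_le /=.
apply: lb_le_inf; first by exists `|r - 0%:~R|, 0.
move=> _ [w _ <-].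
have zf : `|r - z%:~R| <= `|r - f%:~R|.
  by rewrite /z; case: ifP => // /negbT; rewrite -ltNge => /ltW.
have zf1 : `|r - z%:~R| <= `|r - (f + 1)%:~R| by rewrite /z; case: ifP.
have [wf|fw] := leP w f.
  apply: (le_trans zf); have wf' : w%:~R <= f%:~R :> R by rewrite ler_int.
  by rewrite !ger0_norm ?subr_ge0 ?lerD2l ?lerN2 // (le_trans wf').
apply: (le_trans zf1).
have fw' : (f + 1)%:~R <= w%:~R :> R by rewrite ler_int lezD1.
have rw := le_trans (ltW rf) fw'.
by rewrite !ler0_norm ?subr_le0 ?(ltW rf) // !opprB lerD2r.
Qed.

Lemma int_dist_addz (r : R) (z : int) : int_dist (r + z%:~R) = int_dist r.
Proof.
congr (inf _); apply/seteqP; split=> _ [w _ <-].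
  by exists (w - z) => //; congr `|_|; rewrite intrB; ring.
by exists (w + z) => //; congr `|_|; rewrite intrD; ring.
Qed.

Lemma to_circle_eq (r s : R) :
  (to_circle r == to_circle s) = (r - s \is a Num.int).
Proof. by rewrite -Quotient.idealrBE. Qed.

Lemma to_circleD (r s : R) : to_circle (r + s) = to_circle r + to_circle s.
Proof. exact: Quotient.pi_add. Qed.

Lemma circle_norm_to_circle (r : R) : circle_norm (to_circle r) = int_dist r.
Proof.
have /intrP [z rz] : repr (to_circle r) - r \is a Num.int.
  by rewrite -to_circle_eq /to_circle reprK.
by rewrite /circle_norm -[repr _](subrK r) rz addrC int_dist_addz.
Qed.

End CircleFacts.

(* Main.v *)
Require Import Defs.
From HB Require Import structures.
From mathcomp Require Import all_boot all_order all_algebra.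
From mathcomp Require Import all_classical all_reals.
From mathcomp Require Import ring lra zify.

Import Order.TTheory GRing.Theory Num.Theory.

Local Open Scope classical_set_scope.
Local Open Scope ring_scope.

(** Suppose that H_b(J) = H_a(I), and let v(n) be the 2-adic valuation of a_n.

    On the set A of those n with a_n <> 0, the fibres of v lie in I: every
    dyadic rational is in H_b(J) ([Hset_dyadic]), while a_n / 2^(k+1) is an
    odd multiple of 1/2 whenever v(n) = k. The set A itself is not in I, since
    otherwise H_a(I) would be the whole circle, and H_b(J) is not. As ED is not
    Katetov below I restricted to A, some I-positive subset B of A meets every
    fibre of v at most once ([positive_selector]). As J is not Katetov below I
    restricted to B, some D in J has an I-positive preimage C in B under v.

    It remains to find a point x of H_b(J) with ||a_n x|| >= 1/4 for all n in C;
    it will not be in H_a(I). Take x with binary digits supported in D, so that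
    x is in H_b(J) because J is translation invariant ([Hset_bin_real]). For
    v(n) = k, the number a_n x modulo 1 depends only on the digits of x at
    positions k and beyond, and changing the digit at k moves it by 1/2; hence
    one of the two values of this digit is good for n, whatever the later digits
    are. As v is injective on C, each digit serves a single n. So finitely many
    conditions can be met by choosing the digits from the last one down
    ([choose_digits_below]), and compactness of the space of digit sequences
    meets all of them at once ([choose_digits]). The same lemma, with all
    positions allowed and a_n = 2^n, gives a point outside H_b(J). *)

(** * Distance to the nearest integer *)

Lemma int_dist_ge0 (R : realType) (r : R) : 0 <= int_dist r.
Proof. by have [z ->] := int_dist_min r; exact: normr_ge0. Qed.

Lemma int_dist_int (R : realType) (z : int) : int_dist (z%:~R : R) = 0.
Proof.
apply/eqP; rewrite eq_le int_dist_ge0 andbT.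
by rewrite (le_trans (int_dist_le _ z)) // subrr normr0.
Qed.

Lemma int_dist_le_add (R : realType) (r s : R) :
  int_dist r <= int_dist s + `|r - s|.
Proof.
have [z ->] := int_dist_min s; apply: (le_trans (int_dist_le r z)).
have -> : r - z%:~R = (s - z%:~R) + (r - s) by ring.
exact: ler_normD.
Qed.

(** Two points of the circle at distance 1/2 cannot both be at distance less
    than 1/4 from 0; this is what makes one of the two values of a binary digit
    good. *)
Lemma int_dist_half (R : realType) (r : R) (c : int) :
  1/4 <= int_dist r \/ 1/4 <= int_dist (r + (c * 2 + 1)%:~R / 2).
Proof.
have [|r_near] := leP (1/4) (int_dist r); first by left.
have [|s_near] := leP (1/4) (int_dist (r + (c * 2 + 1)%:~R / 2)).
  by right.
have [z rz] := int_dist_min r.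
have [w sw] := int_dist_min (r + (c * 2 + 1)%:~R / 2).
move: r_near s_near; rewrite rz sw !ltr_norml => /andP[r1 r2] /andP[s1 s2].
rewrite intrD intrM in s1 s2.
(* If both distances were below 1/4, the integer w - z - c would lie strictly
   between 0 and 1. *)
have : 0 < (w - z - c)%:~R :> R by rewrite !intrB; lra.
have : (w - z - c)%:~R < 1%:~R :> R by rewrite !intrB; lra.
by rewrite ltr_int ltr0z; lia.
Qed.

(** * Reals given by binary digits *)

Definition bin_sum (R : realType) (d : nat -> bool) (N : nat) : R :=
  \sum_(k < N) (d k)%:R / 2 ^+ k.+1.

Lemma bin_sumS (R : realType) d N :
  bin_sum R d N.+1 = bin_sum R d N + (d N)%:R / 2 ^+ N.+1.
Proof. exact: big_ord_recr. Qed.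

Lemma bin_sum_int (R : realType) d N : 2 ^+ N * bin_sum R d N \is a Num.int.
Proof.
elim: N => [|N IH]; first by rewrite /bin_sum big_ord0 mulr0.
rewrite bin_sumS mulrDr mulrCA divff ?expf_neq0 ?pnatr_eq0 // mulr1.
rewrite exprS -mulrA.
by apply: rpredD; [apply: rpredM => //; apply: intr_nat | apply: intr_nat].
Qed.

Lemma bin_sum_eq (R : realType) (d e : nat -> bool) N :
  (forall k, (k < N)%N -> d k = e k) -> bin_sum R d N = bin_sum R e N.
Proof. by move=> de; apply: eq_bigr => k _; rewrite de. Qed.

Lemma bin_sum_gap (R : realType) (d : nat -> bool) N m :
  (forall i, (i < m)%N -> ~~ d (N + i)%N) ->
  bin_sum R d (N + m) = bin_sum R d N.
Proof.
elim: m => [|m IH] dN; first by rewrite addn0.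
rewrite addnS bin_sumS (negbTE (dN m _)) // mul0r addr0 IH // => i im.
by apply: dN; apply: ltnW.
Qed.

Lemma bin_sum_add_digit (R : realType) (d : nat -> bool) k N :
  (k < N)%N -> ~~ d k ->
  bin_sum R (fun i => (i == k) || d i) N = bin_sum R d N + 1 / 2 ^+ k.+1.
Proof.
move=> kN dk; rewrite /bin_sum (bigD1 (Ordinal kN)) //= eqxx.
rewrite [in RHS](bigD1 (Ordinal kN)) //= (negbTE dk) mul0r add0r addrC.
congr (_ + _); apply: eq_bigr => i; rewrite -val_eqE /= => /negbTE -> //.
Qed.

Lemma bin_sum_mono (R : realType) d M N :
  (M <= N)%N -> bin_sum R d M <= bin_sum R d N.
Proof.
move=> /subnK <-; elim: (N - M)%N => [|n IH] //=.
by rewrite addSn bin_sumS (le_trans IH) // lerDl divr_ge0 ?exprn_ge0.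
Qed.

(** The upper bounds [bin_sum R d N + 2^-N] decrease with N, as digits are at
    most 1; with [bin_sum_mono] they give nested intervals around the real with
    digits d. *)
Lemma bin_sum_tail (R : realType) d M N :
  (M <= N)%N -> bin_sum R d N + (2 ^+ N)^-1 <= bin_sum R d M + (2 ^+ M)^-1.
Proof.
move=> /subnK <-; elim: (N - M)%N => [|n IH] //=.
rewrite addSn bin_sumS (le_trans _ IH) // -addrA lerD2l.
have -> : (2 ^+ (n + M))^-1 = 1 / 2 ^+ (n + M).+1 + (2 ^+ (n + M).+1)^-1 :> R.
  by rewrite exprS; field; rewrite expf_neq0 ?pnatr_eq0.
by rewrite lerD2r ler_pM2r ?invr_gt0 ?exprn_gt0 // lern1 leq_b1.
Qed.

(** The real number whose binary expansion is 0.d_0 d_1 d_2 ..., with d_k of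
    weight 2^-(k+1). *)
Definition bin_real (R : realType) (d : nat -> bool) : R :=
  sup (range (bin_sum R d)).

Lemma bin_real_bounds (R : realType) d N :
  bin_sum R d N <= bin_real R d <= bin_sum R d N + (2 ^+ N)^-1.
Proof.
have ub : ubound (range (bin_sum R d)) (bin_sum R d N + (2 ^+ N)^-1).
  move=> _ [M _ <-]; case: (leqP M N) => [MN|/ltnW NM].
    by rewrite (le_trans (bin_sum_mono R d _ _ MN)) // lerDl invr_ge0 exprn_ge0.
  apply: le_trans (bin_sum_tail R d _ _ NM).
  by rewrite lerDl invr_ge0 exprn_ge0.
apply/andP; split.
  by apply: ub_le_sup; [exists (bin_sum R d N + (2 ^+ N)^-1) | exists N].
by apply: ge_sup => //; exists (bin_sum R d N), N.
Qed.

(** * Choosing digits that keep multiples away from 0 *)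

(** The general form of a sequence of integers whose k-th term has 2-adic
    valuation exactly k. *)
Definition odd_mult (c : nat -> int) (k : nat) : int := 2 ^+ k * (c k * 2 + 1).

Lemma odd_mult_step (R : realType) c k :
  1 / 2 ^+ k.+1 * (odd_mult c k)%:~R = (c k * 2 + 1)%:~R / 2 :> R.
Proof.
rewrite /odd_mult intrM rmorphXn exprS.
by field; rewrite expf_neq0 ?pnatr_eq0.
Qed.

Lemma odd_mult_step_int (R : realType) c k l : (k < l)%N ->
  exists z : int, 1 / 2 ^+ k.+1 * (odd_mult c l)%:~R = z%:~R :> R.
Proof.
move=> kl; exists (2 ^+ (l - k.+1) * (c l * 2 + 1)).
rewrite /odd_mult -(subnK kl) addnK exprD !intrM !rmorphXn /=.
by field; rewrite expf_neq0 ?pnatr_eq0.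
Qed.

(** Digits are chosen downwards, at positions N - 1, N - 2, ..., N - j. The
    digit at position k settles the condition for the k-th multiplier by
    [int_dist_half], and it leaves the conditions for l > k alone, since
    2^-(k+1) times the l-th multiplier is an integer. *)
Lemma choose_digits_below (R : realType) (c : nat -> int) (D : set nat) N j :
  (j <= N)%N ->
  exists2 d : nat -> bool, (forall k, d k -> D k /\ (N - j <= k)%N)
    & forall k, D k -> (N - j <= k < N)%N ->
      1/4 <= int_dist (bin_sum R d N * (odd_mult c k)%:~R).
Proof.
elim: j => [_|j IH jN].
  by exists (fun=> false) => // k _; rewrite subn0 ltnNge andbN.
have [d dD dgood] := IH (ltnW jN); set k := (N - j.+1)%N.
have kS : (N - j)%N = k.+1 by rewrite /k; lia.
rewrite {}kS in dD dgood.
have kN : (k < N)%N by rewrite /k; lia.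
have dk : ~~ d k by apply/negP => /dD[_]; rewrite ltnn.
pose e i := (i == k) || d i.
have es : bin_sum R e N = bin_sum R d N + 1 / 2 ^+ k.+1.
  exact: bin_sum_add_digit.
have egood l : D l -> (k < l < N)%N ->
    1/4 <= int_dist (bin_sum R e N * (odd_mult c l)%:~R).
  move=> Dl /[dup] /andP[kl _] klN; rewrite es mulrDl.
  by have [z ->] := odd_mult_step_int R c _ _ kl; rewrite int_dist_addz dgood.
have kleq l : (k <= l < N)%N -> l = k \/ (k < l < N)%N.
  by rewrite leq_eqVlt => /andP[/orP[/eqP|] kl lN]; [left|right; rewrite kl].
have [] := int_dist_half _ (bin_sum R d N * (odd_mult c k)%:~R) (c k).
  move=> kgood; exists d => [l /dD[Dl /ltnW //]|l Dl /kleq[->//|]].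
  exact: dgood.
rewrite -odd_mult_step -mulrDl -es => kgood.
have [Dk|nDk] := pselect (D k); last first.
  exists d => [l /dD[Dl /ltnW //]|l Dl /kleq[lk|]]; last exact: dgood.
  by rewrite lk in Dl.
exists e => [l /orP[/eqP->//|/dD[Dl /ltnW //]]|l Dl /kleq[->//|]]; exact: egood.
Qed.

(** Compactness of the Cantor space: every sequence u of digit sequences has an
    accumulation point d, found as the limit of u along a free ultrafilter. *)
Lemma digits_cluster_point (u : nat -> nat -> bool) :
  exists d : nat -> bool, forall m, exists2 N, (m <= N)%N &
    forall k, (k < m)%N -> u N k = d k.
Proof.
have [U [Uultra Uoo]] := ultraFilterLemma eventually_filter.
have UF : ProperFilter U by exact: ultra_proper.
exists (fun k => `[< U [set N | u N k] >]) => m.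
suff : U ([set N | (m <= N)%N] `&`
    [set N | forall k, (k < m)%N -> u N k = `[< U [set N | u N k] >]]).
  by move=> /filter_ex[N [mN uN]]; exists N.
apply: filterI; first by apply: Uoo; exists m.
elim: m => [|m IH]; first by apply: filterS filterT.
have : U [set N | u N m = `[< U [set N | u N m] >]].
  have [Um|Um] := pselect (U [set N | u N m]).
    by apply: (filterS _ Um) => N /= ->; apply/esym/asboolP.
  have [//|Um'] := in_ultra_setVsetC [set N | u N m] Uultra.
  apply: filterS Um' => N /= /negP/negbTE ->.
  by apply/esym/negbTE/asboolPn.
move=> H; apply: filterS (filterI IH H) => N [/= IHN uN] k.
by rewrite ltnS leq_eqVlt => /orP[/eqP->|/IHN].
Qed.

(** For a fixed k, the condition on x is closed: it passes from the solutions of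
    the finite problems to an accumulation point of them, as the map sending
    digits to a real is continuous. *)
Lemma choose_digits (R : realType) (c : nat -> int) (D : set nat) :
  exists2 d : nat -> bool, (forall k, d k -> D k) &
    forall k, D k -> 1/4 <= int_dist (bin_real R d * (odd_mult c k)%:~R).
Proof.
have H N := choose_digits_below R c D N N (leqnn N).
pose u N := sval (cid2 (H N)).
have uD N k : u N k -> D k.
  by rewrite /u; case: cid2 => /= e eD _ /eD[].
have ugood N k : D k -> (k < N)%N ->
    1/4 <= int_dist (bin_sum R (u N) N * (odd_mult c k)%:~R).
  by rewrite /u; case: cid2 => /= e _ egood Dk kN; apply: egood; rewrite ?subnn.
have [d dlim] := digits_cluster_point u.
exists d => [k dk|k Dk].
  have [N _ /(_ k (ltnSn k)) uk] := dlim k.+1.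
  by apply: (uD N); rewrite uk.
apply/ler_addgt0Pr => eps eps0; set q := (odd_mult c k)%:~R.
(* Digit sequences that agree below m give reals at distance at most 2^-m, which
   the factor q stretches to at most eps. *)
pose m := maxn k.+1 (Num.bound (`|q| / eps)).
have qm : `|q| * (2 ^+ m)^-1 <= eps.
  rewrite ler_pdivrMr ?exprn_gt0 // mulrC -ler_pdivrMr //.
  by apply/ltW/upper_nthrootP/leq_maxr.
have [N mN uN] := dlim m.
have kN : (k < N)%N by apply: leq_trans mN; apply: leq_maxl.
apply: (le_trans (ugood N k Dk kN)).
apply: (le_trans (int_dist_le_add _ _ (bin_real R d * q))).
rewrite lerD2l -mulrBl normrM mulrC; apply: le_trans qm.
rewrite ler_wpM2l //.
have /andP[d1 d2] := bin_real_bounds R d m.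
have u1 := bin_sum_mono R (u N) _ _ mN.
have u2 : bin_sum R (u N) N <= bin_sum R (u N) m + (2 ^+ m)^-1.
  apply: le_trans (bin_sum_tail R (u N) _ _ mN).
  by rewrite lerDl invr_ge0 exprn_ge0.
move: u1 u2; rewrite (bin_sum_eq R _ d) // => u1 u2.
by rewrite ler_norml; apply/andP; split; lra.
Qed.

(** * Ideals and the Katetov order *)

Lemma ideal_bigcup (I : set (set nat)) (F : nat -> set nat) m :
  is_ideal [set: nat] I -> (forall i, (i < m)%N -> I (F i)) ->
  I (\bigcup_(i in `I_m) F i).
Proof.
move=> hI IF; rewrite bigcup_mkord; elim/big_ind: _ => [||i _].
- exact: (ideal_finite hI).
- exact: ideal_setU hI.
- exact: IF.
Qed.

Lemma not_katetov_le (T : Type) (K : set (set T)) (I : set (set nat))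
    (A : set nat) (f : nat -> T) :
  ~ katetov_le [set: T] K A (ideal_restrict I A) ->
  exists2 E, K E & ~ I (A `&` f @^-1` E).
Proof.
move=> KA; apply: contrapT => noE; apply: KA; exists f; split => // E KE.
exists (A `&` f @^-1` E); last by rewrite setIAC setIid.
by apply: contrapT => IE; apply: noE; exists E.
Qed.

(** ED is generated by the columns and the graphs of functions, so it governs the
    existence of positive selectors. Apply the hypothesis to n |-> (v n, n):
    some E in ED has a positive preimage. Discarding the finitely many fibres
    over the long columns of E leaves fibres of at most m points; numbering the
    points of each fibre splits the rest into m selectors, and one of them is
    positive. *)
Lemma positive_selector (I : set (set nat)) (A : set nat) (v : nat -> nat) :
  is_ideal [set: nat] I ->
  ~ katetov_le [set: nat * nat] ED A (ideal_restrict I A) ->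
  (forall k, I (A `&` v @^-1` [set k])) ->
  exists B, [/\ B `<=` A, ~ I B &
    forall n n', B n -> B n' -> v n = v n' -> n = n'].
Proof.
move=> hI hED Ifib.
have [E [k [m Em]] nIE] := not_katetov_le _ _ _ _ (fun n => (v n, n)) hED.
have /choice[g ginj] : forall i, exists g : nat -> nat, (k < i)%N ->
    (forall j, E (i, j) -> (g j < m)%N) /\
    (forall j j', E (i, j) -> E (i, j') -> g j = g j' -> j = j').
  move=> i; have [ki|ik] := ltnP k i; last by exists id.
  have /pcard_leP[g] := Em i ki; exists g => _; split.
    by move=> j Eij; have := @funS _ _ _ _ g j Eij.
  by move=> j j' Ej Ej' gj; apply: (@inj _ _ _ g) => //; rewrite inE.
apply: contrapT => nosel; apply: nIE.
pose low := \bigcup_(i in `I_k.+1) (A `&` v @^-1` [set i]).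
pose sel c := [set n | [/\ A n, (k < v n)%N, E (v n, n) & g (v n) n = c]].
apply: (ideal_down hI) (low `|` \bigcup_(c in `I_m) sel c) _ _.
  apply: (ideal_setU hI); apply: ideal_bigcup => // c _.
  apply: contrapT => nIsel; apply: nosel; exists (sel c).
  split=> // [n []//|n n' [_ kv En gn] [_ _ En' gn'] vn].
  rewrite -vn in En' gn'.
  by have [_ ] := ginj _ kv; apply=> //; rewrite gn.
move=> n [An /= En]; have [kv|vk] := ltnP k (v n); last by left; exists (v n).
by right; have [gm _] := ginj _ kv; exists (g (v n) n); [exact: gm|split].
Qed.

(** * Multiples of points of the circle *)

Lemma two_adic_decomposition (a : int) : a != 0 ->
  exists c : int, a = 2 ^+ (logn 2 `|a|%N) * (c * 2 + 1).
Proof.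
rewrite -absz_gt0 => a0.
have [m] := pfactor_coprime (isT : prime 2) a0.
rewrite coprime2n => m_odd am.
have [h mh] : exists h : int, Posz m = h * 2 + 1.
  by exists (Posz m./2); have := odd_double_half m; rewrite m_odd; lia.
set p := logn 2 _ in am *.
have am' : `|a| = 2 ^+ p * Posz m.
  by rewrite -abszE am PoszM mulrC -natz natrX.
have [a0'|a0'] := leP 0 a.
  by exists h; rewrite -mh -am' ger0_norm.
exists (- h - 1); move: am'; rewrite ltr0_norm // mh => /(congr1 -%R).
by rewrite opprK => ->; ring.
Qed.

Lemma Hset_to_circle (R : realType) (a : nat -> int) (I : set (set nat))
    (r : R) :
  Hset R a I (to_circle r) <->
  forall e : R, 0 < e -> I [set n | e <= int_dist (r * (a n)%:~R)].
Proof.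
have E n : circle_norm (to_circle r *~ a n) = int_dist (r * (a n)%:~R).
  rewrite -circle_norm_to_circle; congr circle_norm.
  by rewrite mulrzr /to_circle raddfMz.
by rewrite /Hset /=; under eq_forall do under eq_fun do rewrite E.
Qed.

(** The sequence 2^n x is eventually 0, and J contains the finite sets. *)
Lemma Hset_dyadic (R : realType) (J : set (set nat)) k :
  is_ideal [set: nat] J ->
  Hset R (fun n : nat => 2 ^+ n) J (to_circle (1 / 2 ^+ k)).
Proof.
move=> hJ; apply/Hset_to_circle => e e0.
apply: (ideal_finite hJ) => //; apply: (sub_finite_set _ (finite_II k)) => n /=.
apply: contraTT; rewrite -leqNgt -ltNge => kn.
have -> : 1 / 2 ^+ k * (2 ^+ n)%:~R = ((2 ^+ (n - k) : int)%:~R : R).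
  rewrite !rmorphXn /= -{1}(subnK kn) exprD.
  by field; rewrite expf_neq0 ?pnatr_eq0.
by rewrite int_dist_int.
Qed.

(** If 2^n x is not within 2^-m of an integer, then one of the digits of x at
    positions n, ..., n + m - 1 is 1, so n lies in one of the m translates
    D, D - 1, ..., D - (m - 1), all of which are in J. *)
Lemma Hset_bin_real (R : realType) (J : set (set nat)) (d : nat -> bool)
    (D : set nat) :
  is_ideal [set: nat] J -> translation_invariant J ->
  J D -> (forall k, d k -> D k) ->
  Hset R (fun n : nat => 2 ^+ n) J (to_circle (bin_real R d)).
Proof.
move=> hJ hJt JD dD; apply/Hset_to_circle => e e0.
pose m := Num.bound e^-1.
have me : (2 ^+ m)^-1 < e.
  by rewrite invf_plt ?posrE ?exprn_gt0 //; apply/upper_nthrootP.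
apply: (ideal_down hJ) (\bigcup_(i in `I_m) [set n | D (n + i)%N]) _ _.
  by apply: ideal_bigcup => // i _; apply: hJt.
move=> n /= en; apply: contrapT => nD.
have gap i : (i < m)%N -> ~~ d (n + i)%N.
  by move=> im; apply/negP => /dD Dni; apply: nD; exists i.
have /intrP[z zE] := bin_sum_int R d n.
have /andP[lo _] := bin_real_bounds R d n.
(* Since the digits from n to n + m - 1 vanish, x is within 2^-(n+m) of its
   partial sum at n, and 2^n times that partial sum is the integer z. *)
have /andP[_ hi] := bin_real_bounds R d (n + m)%N.
rewrite (bin_sum_gap R d n m gap) in hi.
have p0 : 0 < 2 ^+ n :> R by rewrite exprn_gt0.
have pow2 : (2 ^+ n : int)%:~R = 2 ^+ n :> R by rewrite rmorphXn.
move: en; rewrite pow2 leNgt => /negP; apply.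
apply: le_lt_trans (int_dist_le _ z) _; apply: le_lt_trans me.
rewrite -zE mulrC -mulrBr normrM !ger0_norm ?subr_ge0 // ?(ltW p0) //.
rewrite -ler_pdivlMl // -invfM -exprD; lra.
Qed.

(** * The set H_b(J) is not of the form H_a(I) *)

Theorem theorem2p25 (R : realType) (I J : set (set nat))
  (hI : is_ideal [set: nat] I)
  (hED : forall A : set nat, ideal_positive [set: nat] I A ->
     ~ katetov_le [set: nat * nat] ED A (ideal_restrict I A))
  (hJ : is_ideal [set: nat] J)
  (hJt : translation_invariant J)
  (hJI : forall A : set nat, ideal_positive [set: nat] I A ->
     ~ katetov_le [set: nat] J A (ideal_restrict I A)) :
  ~ scrH R I (Hset R (fun n : nat => 2 ^+ n) J).
Proof.
case=> a _ Hab.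
have q0 : 0 < 1 / 4 :> R by lra.
pose A := [set n | a n != 0]; pose v n := logn 2 `|a n|%N.
(* If a vanished off a set in I, then H_a(I) would be the whole circle; but the
   point constructed here has every 2^k x away from 0, and J is proper. *)
have nIA : ~ I A.
  move=> IA.
  have [d _ dgood] := choose_digits R (fun=> 0) setT.
  have : Hset R a I (to_circle (bin_real R d)).
    apply/Hset_to_circle => e e0; apply: (ideal_down hI) IA _ => n /= en.
    by apply: contraTneq en => ->; rewrite mulr0 (int_dist_int R 0) -ltNge.
  rewrite Hab => /Hset_to_circle/(_ (1/4) q0) Jall.
  apply: (ideal_proper hJ); apply: (ideal_down hJ) Jall _ => // k _ /=.
  by have := dgood k Logic.I; rewrite /odd_mult mul0r add0r mulr1.
(* x = 2^-(k+1) is in H_b(J), and a_n x is an odd multiple of 1/2 if v n = k. *)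
have Ifib k : I (A `&` v @^-1` [set k]).
  have := Hset_dyadic R J k.+1 hJ.
  rewrite -Hab => /Hset_to_circle/(_ (1/4) q0) Ik.
  apply: (ideal_down hI) Ik _ => // n [/= An vn].
  have [c ac] := two_adic_decomposition _ An.
  rewrite ac -/(v n) vn (odd_mult_step R (fun=> c)).
  have [|] := int_dist_half R 0 c; last by rewrite add0r.
  by rewrite (int_dist_int R 0); lra.
have [B [BA nIB vinj]] :=
  positive_selector _ _ v hI (hED A (conj (@subsetT _ _) nIA)) Ifib.
have [D JD nIC] :=
  not_katetov_le _ _ _ _ v (hJI B (conj (@subsetT _ _) nIB)).
(* Injectivity of v on B allows a_n to be indexed by k = v n. *)
have /choice[c aE] : forall k, exists c : int,
    forall n, B n -> v n = k -> a n = 2 ^+ k * (c * 2 + 1).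
  move=> k; have [[n [Bn vn]]|no] := pselect (exists n, B n /\ v n = k).
    have [c ac] := two_adic_decomposition _ (BA n Bn); exists c => n' Bn' vn'.
    by rewrite -vn (vinj n' n) // vn.
  by exists 0 => n Bn vn; case: no; exists n.
have [d dD dgood] := choose_digits R c D.
have := Hset_bin_real R J d D hJ hJt JD dD.
rewrite -Hab => /Hset_to_circle/(_ (1/4) q0) Id.
apply: nIC; apply: (ideal_down hI) Id _ => // n [Bn Dn] /=.
by rewrite (aE _ _ Bn erefl); apply: dgood.
Qed.
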